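(* Let $\Delta\in X$ be given. Then $\theta^n(\Delta)$ converges, as $n\to\infty$, to an equilateral triangle.
   Context: $X\subset(\mathbb{R}^2)^3$ is the set of triples $\Delta=(x_0,x_1,x_2)$ of non-collinear points of the Euclidean plane; such a triple is called a (planar) triangle. Indices are taken in $\mathbb{Z}_3$, i.e. modulo 3, and $\|\cdot\|$ denotes the Euclidean norm. For $\Delta=(x_0,x_1,x_2)\in X$ with centroid $c=\tfrac13(x_0+x_1+x_2)$ set $$r_i=\frac{\|x_{i-1}-c\|}{\|x_i-c\|},\qquad i\in\mathbb{Z}_3,$$ and define the geometric triangle transformation $\theta(x_0,x_1,x_2)=(x_0^{(1)},x_1^{(1)},x_2^{(1)})$ by $$x_i^{(1)}=c+\tfrac23 r_i(x_i-c)-\tfrac13 r_{i+1}(x_{i+1}-c)-\tfrac13 r_{i+2}(x_{i+2}-c),\qquad i\in\mathbb{Z}_3.$$ This maps $X$ to $X$ and keeps the centroid fixed. $\theta^n$ denotes the $n$-fold iterate of $\theta$. *)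

(* Defs.v *)
From mathcomp Require Import all_boot all_order all_algebra.
From mathcomp Require Import all_classical all_reals all_analysis.

Set Implicit Arguments.
Unset Strict Implicit.
Unset Printing Implicit Defensive.

Import Order.TTheory GRing.Theory Num.Theory.
Import numFieldNormedType.Exports.

Local Open Scope ring_scope.

Section Triangles.
Variable R : realType.

Local Notation point := 'rV[R]_2.

(* The library norm `|v| on row vectors is the sup norm, hence this one. *)
Definition enorm (v : point) : R := Num.sqrt (\sum_(j < 2) v 0 j ^+ 2).

(* Vertices are indexed by 'Z_3, so that i + 1, i + 2 and i - 1 wrap around. *)
Definition triple := 'Z_3 -> point.

Definition collinear (x : triple) : Prop :=
  exists p v : point, v != 0 /\ forall i, exists t : R, x i = p + t *: v.

Definition triangle (x : triple) : Prop := ~ collinear x.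

Definition centroid (x : triple) : point := 3^-1 *: (x 0 + x 1 + x 2).

Definition ratio (x : triple) (i : 'Z_3) : R :=
  enorm (x (i - 1) - centroid x) / enorm (x i - centroid x).

(* Total on triples. On a triangle no vertex is the centroid, so the ratios
   never divide by zero. *)
Definition theta (x : triple) : triple := fun i =>
  let c := centroid x in
  c + (2 / 3 * ratio x i) *: (x i - c)
    - (1 / 3 * ratio x (i + 1)) *: (x (i + 1) - c)
    - (1 / 3 * ratio x (i + 2)) *: (x (i + 2) - c).

Definition equilateral (x : triple) : Prop :=
  triangle x /\
  forall i j : 'Z_3, enorm (x (i + 1) - x i) = enorm (x (j + 1) - x j).

End Triangles.

(* Main.v *)
Require Import Defs.
From mathcomp Require Import all_boot all_order all_algebra.
From mathcomp Require Import all_classical all_reals all_analysis.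
From mathcomp Require Import ring lra.

Import Order.TTheory GRing.Theory Num.Theory.
Import numFieldNormedType.Exports.

Local Open Scope classical_set_scope.
Local Open Scope ring_scope.

(** Put y_i = x_i - c, d_i = |y_i|, S = d_0^2 + d_1^2 + d_2^2 (the inertia) and
A = det(y_0, y_1), two thirds of the signed area.  The map theta replaces y_i by
r_i y_i, a vector of length d_(i-1), and then recentres.

- S does not increase, because recentring can only lower a sum of squares
  (inertia_theta).
- A is multiplied by (d_2/d_1 + d_0/d_2 + d_1/d_0) / 3 (area_theta), which is at
  least 1 by the inequality between arithmetic and geometric means.  So |A|
  does not decrease.

With S bounded above and |A| bounded below, all the d_i stay in a fixed interval
[m, M] with m > 0 (rad_bounds).

The defect F = S^2 - 12 A^2 measures the distance to an equilateral shape: since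
y_0 + y_1 + y_2 = 0, it equals twice the sum of the squares of the differences
of the d_i^2 (defectE), so it is nonnegative and vanishes exactly when the d_i
agree.  A quantitative form of the mean inequality (gain_ge) bounds the growth of
A^2 below by a multiple of the same sum of squares.  Hence F decreases by a
constant factor rho < 1 at each step (defect_theta).

A step of theta moves each vertex by at most a constant times sqrt F
(theta_move).  The moves are thus summable and the vertices converge.  By
continuity the limit has F = 0 and A <> 0, so it is an equilateral triangle. *)

Set Implicit Arguments.
Unset Strict Implicit.
Unset Printing Implicit Defensive.

(** * Indices modulo 3 *)

Lemma Z3_ind (P : 'Z_3 -> Prop) : P 0 -> P 1 -> P 2 -> forall i, P i.
Proof.
move=> P0 P1 P2 [[|[|[|//]]] lti].
- by rewrite (_ : Ordinal lti = 0) //; apply/val_inj.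
- by rewrite (_ : Ordinal lti = 1) //; apply/val_inj.
- by rewrite (_ : Ordinal lti = 2) //; apply/val_inj.
Qed.

Lemma Z3E : (((0 - 1)%R = 2 :> 'Z_3) * ((1 - 1)%R = 0 :> 'Z_3) *
  ((2 - 1)%R = 1 :> 'Z_3) * ((0 + 1)%R = 1 :> 'Z_3) * ((1 + 1)%R = 2 :> 'Z_3) *
  ((2 + 1)%R = 0 :> 'Z_3) * ((0 + 2)%R = 2 :> 'Z_3) * ((1 + 2)%R = 0 :> 'Z_3) *
  ((2 + 2)%R = 1 :> 'Z_3))%type.
Proof. by do !split; apply/val_inj. Qed.

(** * A quantitative arithmetic-geometric mean inequality *)

Section Inequalities.
Variable R : realFieldType.
Implicit Types u v w m : R.

(** The mean inequality for w^2 u, u^2 v and v^2 w, whose product is (u v w)^3. *)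
Lemma cyclic_amgm u v w : 0 <= u -> 0 <= v -> 0 <= w ->
  3 * (u * v * w) <= w ^+ 2 * u + u ^+ 2 * v + v ^+ 2 * w.
Proof.
(* Up to a cyclic shift the least variable is a and the next ones are a + s
   and a + t; the difference of the two sides is then the expression below. *)
have key (a s t : R) : 0 <= a -> 0 <= s -> 0 <= t ->
    0 <= a * (s ^+ 2 - s * t + t ^+ 2) + s ^+ 2 * t.
  move=> a0 s0 t0; rewrite addr_ge0 ?mulr_ge0 ?exprn_ge0 //; nra.
move=> u0 v0 w0; have [uv|/ltW vu] := lerP u v.
  have [uw|/ltW wu] := lerP u w.
    have := key u (v - u) (w - u) u0; rewrite !subr_ge0 => /(_ uv uw); lra.
  have := key w (u - w) (v - w) w0.
  rewrite !subr_ge0 => /(_ wu (le_trans wu uv)); lra.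
have [vw|/ltW wv] := lerP v w.
  have := key v (w - v) (u - v) v0; rewrite !subr_ge0 => /(_ vw vu); lra.
have := key w (u - w) (v - w) w0.
rewrite !subr_ge0 => /(_ (le_trans wv vu) wv); lra.
Qed.

(** Three times the sum of the squared deviations from the mean. *)
Definition spread u v w : R := (u - v) ^+ 2 + (v - w) ^+ 2 + (w - u) ^+ 2.

Lemma spread_ge0 u v w : 0 <= spread u v w.
Proof. by rewrite !addr_ge0 ?sqr_ge0. Qed.

(** The excess over the mean inequality at (u, v, w), minus the one at
(u - m, v - m, w - m), is exactly m / 2 times the spread. *)
Lemma cyclic_amgm_spread m u v w : 0 <= m -> m <= u -> m <= v -> m <= w ->
  3 * (u * v * w) + m / 2 * spread u v w
    <= w ^+ 2 * u + u ^+ 2 * v + v ^+ 2 * w.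
Proof.
move=> m0 mu mv mw; have := @cyclic_amgm (u - m) (v - m) (w - m).
rewrite !subr_ge0 => /(_ mu mv mw); rewrite /spread; lra.
Qed.

(** The factor by which theta multiplies the area of a triangle whose vertices are
at distances u, v, w from the centroid. *)
Definition gain u v w : R := (w / v + u / w + v / u) / 3.

Lemma gain_ge m M u v w : 0 < m -> m <= u <= M -> m <= v <= M -> m <= w <= M ->
  1 + m / (6 * M ^+ 3) * spread u v w <= gain u v w.
Proof.
move=> m0 /andP[mu uM] /andP[mv vM] /andP[mw wM].
have u0 : 0 < u by lra.
have v0 : 0 < v by lra.
have w0 : 0 < w by lra.
have M0 : 0 < M by lra.
have uvw0 : 0 < u * v * w by rewrite !mulr_gt0.
have -> : gain u v w
    = (w ^+ 2 * u + u ^+ 2 * v + v ^+ 2 * w) / (3 * (u * v * w)).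
  by rewrite /gain; field; rewrite !gt_eqF.
rewrite ler_pdivlMr; last by lra.
have := cyclic_amgm_spread (ltW m0) mu mv mw.
apply: le_trans; rewrite mulrDl mul1r lerD2l.
have s0 := spread_ge0 u v w.
have uvwM : u * v * w <= M ^+ 3.
  by rewrite exprSr expr2 !ler_pM // ?mulr_ge0 ?ltW.
have -> : m / (6 * M ^+ 3) * spread u v w * (3 * (u * v * w))
    = m / 2 * spread u v w * (u * v * w / M ^+ 3).
  by field; rewrite gt_eqF.
apply: ler_piMr; first by rewrite mulr_ge0 // divr_ge0 // ltW.
by rewrite ler_pdivrMr ?exprn_gt0 // mul1r.
Qed.

Lemma spread_sqr_le M u v w : 0 <= u <= M -> 0 <= v <= M -> 0 <= w <= M ->
  spread (u ^+ 2) (v ^+ 2) (w ^+ 2) <= 4 * M ^+ 2 * spread u v w.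
Proof.
have key (a b : R) : 0 <= a <= M -> 0 <= b <= M ->
    (a ^+ 2 - b ^+ 2) ^+ 2 <= 4 * M ^+ 2 * (a - b) ^+ 2.
  move=> /andP[a0 aM] /andP[b0 bM].
  rewrite subr_sqr exprMn mulrC ler_wpM2r ?sqr_ge0 //.
  by rewrite (_ : 4 * M ^+ 2 = (2 * M) ^+ 2) ?ler_sqr ?nnegrE; [lra..|ring].
move=> hu hv hw; rewrite /spread !mulrDr.
by rewrite !lerD ?key.
Qed.

End Inequalities.

(** * The effect of one step *)

Section OneStep.
Variable R : realType.
(* The bare name is also that of a type of fractions over a ring. *)
Local Notation ratio := (@Defs.ratio R).
Implicit Types (x : triple R) (v w : 'rV[R]_2).

(** The determinant of the vectors v and w. *)
Definition cross v w : R := v 0 0 * w 0 1 - v 0 1 * w 0 0.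

(** The position of a vertex relative to the centroid. *)
Definition dev x (i : 'Z_3) : 'rV[R]_2 := x i - centroid x.

(** The distance of a vertex to the centroid. *)
Definition rad x (i : 'Z_3) : R := enorm (dev x i).

(** Two thirds of the signed area: the determinant of the edge vectors at the
first vertex is three times this one. *)
Definition area x : R := cross (dev x 0) (dev x 1).

(** The polar moment of inertia of three unit masses at the vertices. *)
Definition inertia x : R := rad x 0 ^+ 2 + rad x 1 ^+ 2 + rad x 2 ^+ 2.

(** The defect from the sharp inequality 12 A^2 <= S^2 between area and inertia,
an equality for equilateral triangles.  Squaring makes it blind to orientation. *)
Definition defect x : R := inertia x ^+ 2 - 12 * area x ^+ 2.

Lemma enorm_ge0 v : 0 <= enorm v.
Proof. exact: sqrtr_ge0. Qed.

Lemma sqr_enorm v : enorm v ^+ 2 = v 0 0 ^+ 2 + v 0 1 ^+ 2.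
Proof.
rewrite sqr_sqrtr; last by rewrite sumr_ge0 // => j _; rewrite sqr_ge0.
rewrite !big_ord_recl big_ord0 addr0.
by congr (v 0 _ ^+ 2 + v 0 _ ^+ 2); apply/val_inj.
Qed.

Lemma coord_le_enorm v j : `|v 0 j| <= enorm v.
Proof.
rewrite -(ler_pXn2r (n := 2)) ?nnegrE ?enorm_ge0 // sqr_enorm.
rewrite real_normK ?num_real //.
have [->|->] : j = 0 \/ j = 1.
  by case: j => [[|[|//]] lj]; [left|right]; apply/val_inj.
  by rewrite lerDl sqr_ge0.
by rewrite lerDr sqr_ge0.
Qed.

Lemma dev2 x : dev x 2 = - dev x 0 - dev x 1.
Proof.
by apply/rowP => j; rewrite !mxE; field.
Qed.

Lemma centroid_theta x : centroid (theta x) = centroid x.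
Proof.
by rewrite {1}/centroid /theta !Z3E; apply/rowP => j; rewrite !mxE; field.
Qed.

Lemma dev_theta x i : dev (theta x) i =
  ratio x i *: dev x i
  - 3^-1 *: (ratio x 0 *: dev x 0 + ratio x 1 *: dev x 1 + ratio x 2 *: dev x 2).
Proof.
rewrite /dev centroid_theta /theta; apply/rowP => j.
by elim/Z3_ind: i; rewrite !Z3E !mxE; field.
Qed.

Lemma dev_theta_coord x i j : dev (theta x) i 0 j =
  ratio x i * dev x i 0 j
  - 3^-1 * (ratio x 0 * dev x 0 0 j + ratio x 1 * dev x 1 0 j
            + ratio x 2 * dev x 2 0 j).
Proof. by rewrite dev_theta !mxE. Qed.

Lemma ratioE x i : ratio x i = rad x (i - 1) / rad x i.
Proof. by []. Qed.

(** Heron's formula for the triangle with sides rad x 0, rad x 1 and rad x 2,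
which the three vectors dev x i close up. *)
Lemma defectE x :
  defect x = 2 * spread (rad x 0 ^+ 2) (rad x 1 ^+ 2) (rad x 2 ^+ 2).
Proof.
rewrite /defect /inertia /area /cross /spread /rad dev2 !sqr_enorm !mxE; ring.
Qed.

Lemma area_theta x : (forall i, 0 < rad x i) ->
  area (theta x) = area x * gain (rad x 0) (rad x 1) (rad x 2).
Proof.
move=> r0; rewrite /area /cross !dev_theta !ratioE !Z3E dev2 !mxE /gain.
by field; rewrite !gt_eqF.
Qed.

Lemma inertia_theta x : (forall i, 0 < rad x i) ->
  inertia (theta x) <= inertia x.
Proof.
move=> r0; rewrite {1}/inertia {1 2 3}/rad !sqr_enorm !dev_theta_coord.
(* The vector r_i y_i has length d_(i-1). *)
have rE i : (ratio x i * dev x i 0 0) ^+ 2 + (ratio x i * dev x i 0 1) ^+ 2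
    = rad x (i - 1) ^+ 2.
  have <- : ratio x i * rad x i = rad x (i - 1).
    by rewrite ratioE divfK // gt_eqF.
  by rewrite [RHS]exprMn sqr_enorm; ring.
have := rE 0; have := rE 1; have := rE 2; rewrite !Z3E /inertia.
set a0 := ratio x 0 * dev x 0 0 0; set b0 := ratio x 0 * dev x 0 0 1.
set a1 := ratio x 1 * dev x 1 0 0; set b1 := ratio x 1 * dev x 1 0 1.
set a2 := ratio x 2 * dev x 2 0 0; set b2 := ratio x 2 * dev x 2 0 1.
move=> <- <- <-.
(* Recentring lowers the sum of squares by a third of the square of the sum. *)
have := sqr_ge0 (a0 + a1 + a2); have := sqr_ge0 (b0 + b1 + b2); lra.
Qed.

Lemma area_le_rad x i : area x ^+ 2 <= rad x i ^+ 2 * inertia x.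
Proof.
(* Lagrange's identity gives det(v, w)^2 <= |v|^2 |w|^2. *)
have key v w z : cross v w ^+ 2
    <= enorm v ^+ 2 * (enorm v ^+ 2 + enorm w ^+ 2 + enorm z ^+ 2).
  rewrite !sqr_enorm /cross -subr_ge0.
  have -> : forall a b c d e f : R, (a ^+ 2 + b ^+ 2) *
     (a ^+ 2 + b ^+ 2 + (c ^+ 2 + d ^+ 2) + (e ^+ 2 + f ^+ 2))
     - (a * d - b * c) ^+ 2 = (a ^+ 2 + b ^+ 2) ^+ 2
       + (a ^+ 2 + b ^+ 2) * (e ^+ 2 + f ^+ 2) + (a * c + b * d) ^+ 2.
    by move=> *; ring.
  by rewrite !addr_ge0 ?sqr_ge0 // mulr_ge0 // addr_ge0 ?sqr_ge0.
rewrite /area /inertia; elim/Z3_ind: i.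
- exact: key.
- have := key (dev x 1) (dev x 0) (dev x 2); rewrite /rad /cross; lra.
- have := key (dev x 2) (dev x 0) (dev x 1).
  have -> : cross (dev x 2) (dev x 0) = cross (dev x 0) (dev x 1).
    by rewrite /cross dev2 !mxE; ring.
  by rewrite /rad; lra.
Qed.

Lemma rad_le_inertia x i : rad x i ^+ 2 <= inertia x.
Proof.
rewrite /inertia; have := sqr_ge0 (rad x 0); have := sqr_ge0 (rad x 1).
by have := sqr_ge0 (rad x 2); elim/Z3_ind: i; lra.
Qed.

(** The inertia does not increase, so the defect drops by at least the growth of
12 A^2, which gain_ge bounds below in terms of the defect itself. *)
Lemma defect_theta x m M a : 0 < m -> (forall i, m <= rad x i <= M) ->
  0 <= a -> a <= area x ^+ 2 ->
  defect (theta x) <= (1 - a * m / (2 * M ^+ 5)) * defect x.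
Proof.
move=> m0 hr a0 aA.
have r0 i : 0 < rad x i by have /andP[] := hr i; lra.
have M0 : 0 < M by have /andP[] := hr 0; lra.
have hr0 i : 0 <= rad x i <= M by have /andP[_ ->] := hr i; rewrite ltW.
have := gain_ge m0 (hr 0) (hr 1) (hr 2).
have := spread_sqr_le (hr0 0) (hr0 1) (hr0 2).
rewrite /defect -/(defect x) area_theta // exprMn.
have : inertia (theta x) ^+ 2 <= inertia x ^+ 2.
  by rewrite ler_sqr ?nnegrE ?inertia_theta // /inertia !addr_ge0 ?sqr_ge0.
set q := gain _ _ _; set G := spread (rad x 0) _ _ => hI hF hq.
have G0 : 0 <= G := spread_ge0 _ _ _.
have c0 : 0 <= m / (6 * M ^+ 3) by rewrite divr_ge0 ?mulr_ge0 ?exprn_ge0 ?ltW.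
(* q^2 - 1 >= 2 (q - 1). *)
have hq2 : 2 * (m / (6 * M ^+ 3) * G) <= q ^+ 2 - 1.
  have := mulr_ge0 c0 G0; nra.
have h1 : a * (2 * (m / (6 * M ^+ 3) * G)) <= area x ^+ 2 * (q ^+ 2 - 1).
  by rewrite ler_pM // mulr_ge0 // mulr_ge0.
have h2 : a * m / (2 * M ^+ 5) * defect x
    <= 12 * (a * (2 * (m / (6 * M ^+ 3) * G))).
  have -> : 12 * (a * (2 * (m / (6 * M ^+ 3) * G))) =
      a * m / (2 * M ^+ 5) * (2 * (4 * M ^+ 2 * G)).
    by field; rewrite gt_eqF.
  rewrite defectE ler_wpM2l ?ler_wpM2l //.
  by rewrite divr_ge0 ?mulr_ge0 ?exprn_ge0 // ltW.
rewrite mulrBl mul1r /defect; rewrite /defect in h2; lra.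
Qed.

Lemma area_theta_ge x m M : 0 < m -> (forall i, m <= rad x i <= M) ->
  area x ^+ 2 <= area (theta x) ^+ 2.
Proof.
move=> m0 hr.
have r0 i : 0 < rad x i by have /andP[] := hr i; lra.
have M0 : 0 < M by have /andP[] := hr 0; lra.
rewrite area_theta // exprMn ler_peMr ?sqr_ge0 // expr_ge1 //.
all: have := gain_ge m0 (hr 0) (hr 1) (hr 2).
all: have : 0 <= m / (6 * M ^+ 3) * spread (rad x 0) (rad x 1) (rad x 2)
  by rewrite mulr_ge0 ?spread_ge0 // divr_ge0 ?mulr_ge0 ?exprn_ge0 ?ltW.
all: lra.
Qed.

Lemma defect_ge0 x : 0 <= defect x.
Proof. by rewrite defectE mulr_ge0 ?spread_ge0. Qed.

(** The move of a vertex is a combination of the vectors (r_k - 1) y_k, of length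
|d_(k-1) - d_k|, and the defect controls the differences of the d_k^2. *)
Lemma theta_move x m i j : 0 < m -> (forall i, m <= rad x i) ->
  `|theta x i 0 j - x i 0 j| <= 2 / m * Num.sqrt (defect x).
Proof.
move=> m0 hr.
have r0 i' : 0 < rad x i' by have := hr i'; lra.
set e := Num.sqrt (defect x).
have e0 : 0 <= e by exact: sqrtr_ge0.
have e2 : e ^+ 2 = defect x by rewrite sqr_sqrtr ?defect_ge0.
have key k : `|(ratio x k - 1) * dev x k 0 j| <= e / m.
  have : `|(ratio x k - 1) * dev x k 0 j| <= `|rad x (k - 1) - rad x k|.
    rewrite normrM.
    have -> : ratio x k - 1 = (rad x (k - 1) - rad x k) / rad x k.
      by rewrite ratioE; field; rewrite gt_eqF.
    rewrite normrM normfV -mulrA ler_piMr // mulrC (gtr0_norm (r0 k)).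
    by rewrite ler_pdivrMr // mul1r coord_le_enorm.
  move/le_trans; apply; rewrite ler_pdivlMr //.
  rewrite -(ler_pXn2r (n := 2)) ?nnegrE // ?mulr_ge0 ?(ltW m0) //.
  rewrite e2 exprMn real_normK ?num_real //.
  apply: (@le_trans _ _ ((rad x (k - 1) ^+ 2 - rad x k ^+ 2) ^+ 2)).
    rewrite subr_sqr exprMn ler_wpM2l ?sqr_ge0 //.
    by rewrite ler_sqr ?nnegrE; have := hr (k - 1); have := hr k; lra.
  rewrite defectE /spread.
  have := sqr_ge0 (rad x 0 ^+ 2 - rad x 1 ^+ 2).
  have := sqr_ge0 (rad x 1 ^+ 2 - rad x 2 ^+ 2).
  have := sqr_ge0 (rad x 2 ^+ 2 - rad x 0 ^+ 2).
  by elim/Z3_ind: k; rewrite !Z3E; lra.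
(* The vectors y_k sum to zero, so r_k may be replaced by r_k - 1 everywhere. *)
have -> : theta x i 0 j - x i 0 j = (ratio x i - 1) * dev x i 0 j
    - 3^-1 * ((ratio x 0 - 1) * dev x 0 0 j + (ratio x 1 - 1) * dev x 1 0 j
              + (ratio x 2 - 1) * dev x 2 0 j).
  have -> : theta x i 0 j - x i 0 j = dev (theta x) i 0 j - dev x i 0 j.
    by rewrite /dev centroid_theta !mxE; ring.
  by rewrite dev_theta dev2 !mxE; field.
have := key 0; have := key 1; have := key 2; have := key i.
rewrite (_ : 2 / m * e = 2 * (e / m)); last by field; rewrite gt_eqF.
rewrite !ler_norml => /andP[? ?] /andP[? ?] /andP[? ?] /andP[? ?].
by apply/andP; split; lra.
Qed.

Lemma collinear_area x : collinear x <-> area x = 0.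
Proof.
have areaE : 3 * area x = cross (x 1 - x 0) (x 2 - x 0).
  by rewrite /area /cross /dev /centroid !mxE; field.
split=> [[p [v [_ px]]]|a0].
  apply: (@mulfI _ 3) => //; rewrite mulr0 areaE /cross.
  have [t0 ->] := px 0; have [t1 ->] := px 1; have [t2 ->] := px 2.
  by rewrite !mxE; ring.
have {areaE a0} : cross (x 1 - x 0) (x 2 - x 0) = 0 by rewrite -areaE a0 mulr0.
have rowE v w : v 0 0 = w 0 0 -> v 0 1 = w 0 1 -> v = w.
  move=> h0 h1; apply/rowP => j.
  have [->//|->//] : j = 0 \/ j = 1.
  by case: j => [[|[|//]] lj]; [left|right]; apply/val_inj.
(* The coefficient is that of the orthogonal projection of w on v. *)
have line v w : v != 0 -> cross v w = 0 -> exists t, w = t *: v.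
  move=> v0 vw0.
  have n0 : v 0 0 ^+ 2 + v 0 1 ^+ 2 != 0.
    apply: contraNneq v0 => /eqP; rewrite paddr_eq0 ?sqr_ge0 // !sqrf_eq0.
    by move=> /andP[/eqP h0 /eqP h1]; apply/eqP/rowE; rewrite mxE.
  exists ((v 0 0 * w 0 0 + v 0 1 * w 0 1) / (v 0 0 ^+ 2 + v 0 1 ^+ 2)).
  move: vw0; rewrite /cross => /eqP; rewrite subr_eq0 => /eqP vw0.
  apply: rowE; rewrite mxE; apply: (mulIf n0); rewrite mulrAC divfK //.
    by rewrite !mulrDl !mulrDr; ring: vw0.
  by rewrite !mulrDl !mulrDr; ring: vw0.
have colE t (v : 'rV[R]_2) (k : 'Z_3) : x k - x 0 = t *: v -> x k = x 0 + t *: v.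
  by move=> <-; rewrite addrC subrK.
have x00 v : x 0 = x 0 + 0 *: v by rewrite scale0r addr0.
have [e0|en0] := eqVneq (x 1 - x 0) 0; last first.
  move=> /(line _ _ en0)[t ht]; exists (x 0), (x 1 - x 0); split=> //.
  elim/Z3_ind; first by exists 0.
  - by exists 1; apply: colE; rewrite scale1r.
  - by exists t; apply: colE.
have [f0|fn0] := eqVneq (x 2 - x 0) 0 => _.
  exists (x 0), (const_mx 1); split.
    by apply/eqP => /rowP /(_ 0) /eqP; rewrite !mxE oner_eq0.
  by elim/Z3_ind; exists 0; apply: colE; rewrite scale0r // subrr.
exists (x 0), (x 2 - x 0); split=> //.
elim/Z3_ind; first by exists 0.
- by exists 0; apply: colE; rewrite scale0r.
- by exists 1; apply: colE; rewrite scale1r.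
Qed.

Lemma equilateral_of_defect x : area x != 0 -> defect x = 0 -> equilateral x.
Proof.
move=> a0 d0; split; first by move/collinear_area/eqP; rewrite (negPf a0).
have := d0; rewrite defectE => /eqP; rewrite mulf_eq0 pnatr_eq0 /= /spread.
rewrite !paddr_eq0 ?addr_ge0 ?sqr_ge0 // !sqrf_eq0 !subr_eq0.
move=> /andP[/andP[/eqP r01 /eqP r12] _].
(* Since y_i + y_(i+1) = - y_(i+2), the parallelogram law gives each side in
   terms of the three distances. *)
suff side i : enorm (x (i + 1) - x i) ^+ 2 = 3 * rad x 0 ^+ 2.
  move=> i j; apply: (@pexpIrn _ 2); rewrite ?nnegrE ?enorm_ge0 //.
  by rewrite !side.
have -> : 3 * rad x 0 ^+ 2 = 2 * rad x i ^+ 2 + 2 * rad x (i + 1) ^+ 2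
    - rad x (i + 2) ^+ 2.
  by elim/Z3_ind: i; rewrite !Z3E; lra.
have -> : x (i + 1) - x i = dev x (i + 1) - dev x i.
  by rewrite /dev opprB addrA subrK.
by rewrite /rad !sqr_enorm; elim/Z3_ind: i; rewrite !Z3E dev2 !mxE; ring.
Qed.

Lemma rad_bounds x a M : 0 < M -> 0 <= a -> a ^+ 2 <= area x ^+ 2 ->
  inertia x <= M ^+ 2 -> forall i, a / M <= rad x i <= M.
Proof.
move=> M0 a0 aA IM i; have r0 := enorm_ge0 (dev x i); rewrite -/(rad x i) in r0.
apply/andP; split; last first.
  rewrite -(ler_pXn2r (n := 2)) ?nnegrE ?(ltW M0) //.
  exact: le_trans (rad_le_inertia x i) IM.
rewrite ler_pdivrMr // -(ler_pXn2r (n := 2)) ?nnegrE ?mulr_ge0 ?(ltW M0) //.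
rewrite exprMn (le_trans aA) // (le_trans (area_le_rad x i)) //.
by rewrite ler_wpM2l ?sqr_ge0.
Qed.

End OneStep.

(** * Convergence *)

Section Limits.
Variable R : realType.

Lemma cvg_of_geometric_increments (u : nat -> R) (C q : R) : 0 <= q < 1 ->
  (forall n, `|u n.+1 - u n| <= C * q ^+ n) -> cvg (u @ \oo).
Proof.
move=> /andP[q0 q1] hu.
have C0 : 0 <= C by have := hu 0%N; rewrite expr0 mulr1; apply: le_trans.
have -> : u = (fun n => u 0%N + series (telescope u) n).
  by apply/funext => n; exact: eq_sum_telescope.
apply: is_cvgD; first exact: is_cvg_cst.
apply: normed_cvg.
apply: (@series_le_cvg _ _ (geometric C q)).
- by move=> n; exact: normr_ge0.
- by move=> n; rewrite /= mulr_ge0 ?exprn_ge0.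
- by move=> n; exact: hu.
- by apply: is_cvg_geometric_series; rewrite ger0_norm.
Qed.

Lemma cvg_mx_coord m n (F : nat -> 'M[R]_(m, n)) (L : 'M[R]_(m, n)) :
  (forall i j, (fun k => F k i j) @ \oo --> L i j) -> F @ \oo --> L.
Proof.
move=> h A [P LP PA].
have : \forall k \near \oo, forall ij : 'I_m * 'I_n, P ij.1 ij.2 (F k ij.1 ij.2).
  by apply: filter_forall => ij; exact: h (LP ij.1 ij.2).
by apply: filterS => k hk; apply: PA => i j; exact: (hk (i, j)).
Qed.

Lemma cvg_area_defect (x : nat -> triple R) (L : triple R) :
  (forall i j, (fun n => x n i 0 j) @ \oo --> L i 0 j) ->
  (fun n => area (x n)) @ \oo --> area L /\
  (fun n => defect (x n)) @ \oo --> defect L.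
Proof.
move=> xL.
have cd i j : (fun n => dev (x n) i 0 j) @ \oo --> dev L i 0 j.
  have -> : (fun n => dev (x n) i 0 j)
      = (fun n => x n i 0 j - 3^-1 * (x n 0 0 j + x n 1 0 j + x n 2 0 j)).
    by apply/funext => n; rewrite !mxE.
  rewrite !mxE; apply: cvgB; first exact: xL.
  apply: cvgM; first exact: cvg_cst.
  by apply: cvgD; [apply: cvgD|]; exact: xL.
have ca : (fun n => area (x n)) @ \oo --> area L.
  by apply: cvgB; apply: cvgM; exact: cd.
split=> //.
have sqr (f : nat -> R) (l : R) :
    f @ \oo --> l -> (fun n => f n ^+ 2) @ \oo --> l ^+ 2.
  by move=> fl; under eq_fun do rewrite expr2; rewrite expr2; exact: cvgM.
have cr i : (fun n => rad (x n) i ^+ 2) @ \oo --> rad L i ^+ 2.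
  rewrite /rad; under eq_fun do rewrite sqr_enorm.
  by rewrite sqr_enorm; apply: cvgD; apply: sqr; exact: cd.
apply: cvgB; last by apply: cvgM; [exact: cvg_cst|exact: sqr].
by apply: sqr; apply: cvgD; [apply: cvgD|]; exact: cr.
Qed.

End Limits.

Unset Implicit Arguments.

Theorem theorem2p1 (R : realType) (D : triple R) (hD : triangle D) :
  exists L : triple R, equilateral L /\
    forall i : 'Z_3, (fun n : nat => iter n (@theta R) D i) @ \oo --> L i.
Proof.
pose x n := iter n (@theta R) D.
have A0 : area D != 0 by apply/eqP => /collinear_area.
pose a := `|area D|.
have a0 : 0 < a by rewrite normr_gt0.
have a2 : a ^+ 2 = area D ^+ 2 by rewrite real_normK ?num_real.
have I0 : 0 < inertia D.
  rewrite lt_neqAle eq_sym !addr_ge0 ?sqr_ge0 // andbT.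
  apply: contraNneq A0 => I0; have := area_le_rad D 0; rewrite I0 mulr0.
  by rewrite le_eqVlt ltNge sqr_ge0 orbF sqrf_eq0.
pose M := Num.sqrt (inertia D).
have M0 : 0 < M by rewrite sqrtr_gt0.
have M2 : M ^+ 2 = inertia D by rewrite sqr_sqrtr ?ltW.
pose m := a / M.
have m0 : 0 < m by rewrite divr_gt0.
have inv n : a ^+ 2 <= area (x n) ^+ 2 /\ inertia (x n) <= M ^+ 2.
  elim: n => [|n [IHa IHI]]; first by rewrite a2 M2.
  have hr := rad_bounds M0 (ltW a0) IHa IHI.
  split; first exact: le_trans IHa (area_theta_ge m0 hr).
  apply: le_trans IHI; apply: inertia_theta => i.
  by have /andP[] := hr i; rewrite -/m; lra.
have hr n i : m <= rad (x n) i <= M.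
  by have [? ?] := inv n; apply: rad_bounds => //; exact: ltW.
pose rho := 1 - a ^+ 2 * m / (2 * M ^+ 5).
have mM : m <= M by have /andP[] := hr 0%N 0; exact: le_trans.
(* Nonnegativity of rho comes from a = m M and m <= M. *)
have rho01 : 0 <= rho < 1.
  have p0 : 0 < 2 * M ^+ 5 by rewrite mulr_gt0 ?exprn_gt0.
  apply/andP; split; last first.
    by rewrite ltrBlDr ltrDl divr_gt0 // mulr_gt0 // exprn_gt0.
  rewrite subr_ge0 ler_pdivrMr // mul1r.
  have -> : a = m * M by rewrite /m divfK // gt_eqF.
  have -> : (m * M) ^+ 2 * m = M ^+ 2 * m ^+ 3 by ring.
  have -> : 2 * M ^+ 5 = M ^+ 2 * (M ^+ 3 + M ^+ 3) by ring.
  rewrite ler_wpM2l ?sqr_ge0 //.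
  have : m ^+ 3 <= M ^+ 3 by rewrite lerXn2r ?nnegrE ?(ltW m0) ?(ltW M0).
  by have := exprn_gt0 3 M0; lra.
have /andP[rho0 rho1] := rho01.
have dec n : defect (x n) <= defect D * rho ^+ n.
  elim: n => [|n IH]; first by rewrite mulr1.
  have [ha _] := inv n.
  apply: le_trans (defect_theta m0 (hr n) (sqr_ge0 a) ha) _.
  by rewrite -/rho exprS mulrCA ler_wpM2l.
have cx i j : cvg ((fun n => x n i 0 j) @ \oo).
  apply: (@cvg_of_geometric_increments _ _ (2 / m * Num.sqrt (defect D))
    (Num.sqrt rho)).
    by rewrite sqrtr_ge0 /= -[ltRHS]sqrtr1 ltr_sqrt.
  move=> n.
  apply: le_trans (theta_move i j m0 (fun i => (andP (hr n i)).1)) _.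
  rewrite -[leRHS]mulrA ler_wpM2l //; first by rewrite divr_ge0 // ltW.
  rewrite -(ler_pXn2r (n := 2)) ?nnegrE ?mulr_ge0 ?exprn_ge0 ?sqrtr_ge0 //.
  by rewrite exprMn exprAC !sqr_sqrtr ?defect_ge0.
pose L : triple R := fun i => \row_j lim ((fun n => x n i 0 j) @ \oo).
have xL i j : (fun n => x n i 0 j) @ \oo --> L i 0 j by rewrite mxE; exact: cx.
have [cA cF] := cvg_area_defect xL.
exists L; split; last first.
  by move=> i; apply: cvg_mx_coord => k j; rewrite !ord1; exact: xL.
apply: equilateral_of_defect.
  suff : a ^+ 2 <= area L ^+ 2.
    by apply: contraTneq => ->; rewrite expr0n /= -ltNge exprn_gt0.
  apply: (@cvgr_to_ge _ \oo _ _ (fun n => area (x n) ^+ 2)).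
    under eq_fun do rewrite expr2.
    by rewrite expr2; exact: cvgM.
  by apply: nearW => n; have [] := inv n.
apply/eqP; rewrite eq_le defect_ge0 andbT.
have c0 : (fun n => defect D * rho ^+ n) @ \oo --> 0.
  by apply: cvg_geometric; rewrite ger0_norm.
apply: ler_cvg_to cF c0 _; apply: nearW => n; exact: dec.
Qed.
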